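(* Let $\mathbf{D}'$ be the category whose objects are naturally ordered finite distributive lattices and whose morphisms are positive surjective lattice homomorphisms. Then $\mathbf{D}'$ has the dual Ramsey property (for morphisms); that is, for every integer $k\ge2$ and all objects $\mathcal{K}_\prec$, $\mathcal{L}_\sqsubset$ of $\mathbf{D}'$ with $\hom_{\mathbf{D}'}(\mathcal{L}_\sqsubset,\mathcal{K}_\prec)\neq\varnothing$ there is an object $\mathcal{N}_\triangleleft$ of $\mathbf{D}'$ such that for every $k$-coloring $\hom_{\mathbf{D}'}(\mathcal{N}_\triangleleft,\mathcal{K}_\prec)=\mathcal{M}_1\cup\dots\cup\mathcal{M}_k$ there are $i\in\{1,\dots,k\}$ and $w\in\hom_{\mathbf{D}'}(\mathcal{N}_\triangleleft,\mathcal{L}_\sqsubset)$ such that $f\circ w\in\mathcal{M}_i$ for all $f\in\hom_{\mathbf{D}'}(\mathcal{L}_\sqsubset,\mathcal{K}_\prec)$.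
   Context: Lattices have bottom $0$ and top $1$ in the signature, and homomorphisms preserve them; $\le$ (strict part $<$) denotes the lattice order. $J(\mathcal{L})$ is the set of join-irreducible elements of $\mathcal{L}$ ($0$ is not join-irreducible); the empty join is $0$. Natural order: let $\sqsubset^0$ be a (strict) linear order on $J(\mathcal{L})$ extending $<$ on $J(\mathcal{L})$, and write $J(\mathcal{L})=\{j_1\sqsubset^0\dots\sqsubset^0 j_n\}$. For $x\in L$ let $\delta_i(x)=1$ if $j_i\le x$ and $\delta_i(x)=0$ otherwise. The antilexicographic order $\sqsubset$ on $L$ with respect to $\sqsubset^0$ is: $x\sqsubset y$ iff there is $s$ with $\delta_s(x)<\delta_s(y)$ and $\delta_t(x)=\delta_t(y)$ for all $t>s$. A linear order on $L$ is natural if it arises this way from some such $\sqsubset^0$. A naturally ordered finite distributive lattice $\mathcal{L}_\sqsubset$ is a finite distributive lattice $\mathcal{L}$ together with a natural linear order $\sqsubset$; $\sqsubseteq$ is the reflexive version of $\sqsubset$. For a lattice homomorphism $f:\mathcal{L}\to\mathcal{K}$ let $N(f)=\{x\in L : \exists y\in L\ (y<x \text{ and } f(y)=f(x))\}$, and for $x\in L$, $S\subseteq L$ let $x-S=\bigvee\{j\in J(\mathcal{L}) : j\le x,\ j\notin S\}$. A lattice homomorphism $f$ from $\mathcal{L}_\sqsubset$ to $\mathcal{K}_\prec$ is positive if for all $x,y\in L$: $x-N(f)\sqsubseteq y-N(f)$ implies $f(x)\preceq f(y)$. A $k$-coloring of a set is a decomposition of it into $k$ pairwise disjoint (possibly empty)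 subsets. Positive surjective homomorphisms are closed under composition and contain the identities, so $\mathbf{D}'$ is a category. *)

(* Defs.v *)
From HB Require Import structures.
From mathcomp Require Import all_boot all_order.

Set Implicit Arguments.
Unset Strict Implicit.
Unset Printing Implicit Defensive.

Import Order.TTheory.
Local Open Scope order_scope.

Section NaturalOrders.
Context {d : Order.disp_t} {L : finTBDistrLatticeType d}.

Definition join_irreducible (x : L) : bool :=
  (x != \bot) &&
  [forall y : L, forall z : L, (x == y `|` z) ==> ((x == y) || (x == z))].

(* r is only constrained on join-irreducibles; its other values are irrelevant
   to antilex. *)
Definition linear_extension (r : rel L) : Prop :=
  [/\ {in join_irreducible, irreflexive r},
      {in join_irreducible & &, transitive r},
      {in join_irreducible &, forall a b, a != b -> r a b || r b a}
    & {in join_irreducible &, forall a b, a < b -> r a b}].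

Definition delta (j x : L) : nat := (j <= x)%O.

(* The join-irreducibles themselves, ordered by r, serve as the indices
   s and t; "t > s" is r s t. *)
Definition antilex (r : rel L) (x y : L) : bool :=
  [exists s in join_irreducible,
     (delta s x < delta s y)%N &&
     [forall t in join_irreducible, r s t ==> (delta t x == delta t y)]].

Definition natural_order (lt : rel L) : Prop :=
  exists2 r : rel L, linear_extension r & lt =2 antilex r.

Definition diff_join (x : L) (S : {set L}) : L :=
  \join_(j : L | [&& join_irreducible j, j <= x & j \notin S]) j.

End NaturalOrders.

Record natOrdLattice := NatOrdLattice {
  nol_disp : Order.disp_t;
  nol_sort :> finTBDistrLatticeType nol_disp;
  nol_lt : rel nol_sort;
  nol_natural : natural_order nol_lt
}.

Definition nol_le (L : natOrdLattice) (x y : L) : bool :=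
  (x == y) || nol_lt x y.

Section Morphisms.
Context {L K : natOrdLattice}.

(* The library's {tblmorphism L -> K} only asks for preservation of \bot and
   \top, not of meets and joins, so it is not used here. *)
Definition lattice_hom (f : L -> K) : Prop :=
  [/\ Order.meet_morphism f, Order.join_morphism f,
      f \bot = \bot & f \top = \top].

Definition noninjectivity_set (f : L -> K) : {set L} :=
  [set x : L | [exists y : L, (y < x) && (f y == f x)]].

Definition positive (f : L -> K) : Prop :=
  forall x y : L,
    nol_le (diff_join x (noninjectivity_set f))
           (diff_join y (noninjectivity_set f)) ->
    nol_le (f x) (f y).

Definition surjective (f : L -> K) : Prop := forall y : K, exists x : L, f x = y.

End Morphisms.

(* Morphisms are finite functions, so that hom-sets are (proof-irrelevantly)
   subsets of a finite type. *)
Definition is_hom (L K : natOrdLattice) (f : {ffun L -> K}) : Prop :=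
  [/\ lattice_hom f, surjective f & positive f].

Definition comp_hom (N L K : natOrdLattice)
    (f : {ffun L -> K}) (w : {ffun N -> L}) : {ffun N -> K} :=
  [ffun x => f (w x)].

Definition is_coloring (T : finType) (P : T -> Prop) (k : nat)
    (M : 'I_k -> {set T}) : Prop :=
  (forall x : T, P x <-> exists i : 'I_k, x \in M i) /\
  (forall i j : 'I_k, i != j -> [disjoint M i & M j]).

(* Main.v *)
(* Birkhoff duality turns a positive surjective homomorphism L -> K into a rigid
   surjection of the chains L and K: every element of K has a least preimage for
   the natural order of L, and positivity says that these preimages increase.
   Conversely, let N be the free distributive lattice on n generators, the up-sets
   of the cube {0,1}^n, with join-irreducibles (the cube) ordered by the first
   coordinate where they differ.  A rigid surjection W from n onto the chain K
   extends to a homomorphism N -> K; its dual sends a join-irreducible j to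
   {t | j <= W t}, and rigidity of W makes this embedding monotone, i.e. the
   homomorphism is positive.  Since f o ext(W) = ext(f o W), the theorem follows
   from the Graham-Rothschild theorem for rigid surjections, which is proved from
   the Hales-Jewett theorem by induction on the number of parameters. *)
Require Import Defs.
From HB Require Import structures.
From mathcomp Require Import all_boot all_order.
From mathcomp Require Import zify.

Set Implicit Arguments.
Unset Strict Implicit.
Unset Printing Implicit Defensive.

(** * Words with parameters *)

(* Restricted growth strings: the letters below [b] form the alphabet, the
   letters [b], ..., [e - 1] are parameters, all of which occur and whose first
   occurrences are in increasing order.  For [b = 0] these are the rigid
   surjections onto [e]. *)
Fixpoint rg (b e : nat) (s : seq nat) : bool :=
  if s is x :: s' then
    if x == b then rg b.+1 e s' else (x < b) && rg b e s'
  else b == e.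

Definition letter_subst (a : nat) (G : seq nat) (i : nat) : nat :=
  if i < a then i else nth 0 G (i - a).

(** Words are read as functions on positions: [wcomp 0 F G] is the composite of [G] after [F], and
    for general [a] the word [G] is substituted for the parameters of [F]. *)
Definition wcomp (a : nat) (F G : seq nat) : seq nat := map (letter_subst a G) F.

(** If [y] does not occur the whole word is returned, so the index after the last parameter gives
    back the full word. *)
Definition before (y : nat) (s : seq nat) : seq nat := take (index y s) s.

Fixpoint words (a n : nat) : seq (seq nat) :=
  if n is n'.+1 then [seq b :: w | b <- iota 0 a, w <- words a n'] else [:: [::]].

Lemma rg_leq b e s : rg b e s -> b <= e.
Proof.
elim: s b => [|x s IH] b /=; first by move/eqP->.
case: eqP => _; first by move/IH/ltnW.
by case/andP=> _; apply: IH.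
Qed.

Lemma rg_lt b e s x : rg b e s -> x \in s -> x < e.
Proof.
elim: s b => [|y s IH] b //=; rewrite inE.
case: (y =P b) => [->|_].
  move=> rs /orP[/eqP->|]; last exact: IH rs.
  exact: rg_leq rs.
case/andP=> yb rs /orP[/eqP->|]; last exact: IH rs.
exact: leq_trans yb (rg_leq rs).
Qed.

Lemma rg_cat b c e s t : rg b c s -> rg c e t -> rg b e (s ++ t).
Proof.
elim: s b => [|x s IH] b /=; first by move/eqP->.
case: eqP => _; first exact: IH.
by case/andP=> -> rs rt; apply: IH.
Qed.

Lemma rg_iota b m : rg b (b + m) (iota b m).
Proof. by elim: m b => [|m IH] b /=; rewrite ?addn0 // eqxx addnS -addSn IH. Qed.

Lemma rg_nseq b x n : x < b -> rg b b (nseq n x).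
Proof. by move=> xb; elim: n => //= n ->; rewrite (ltn_eqF xb) xb. Qed.

(** Invariant of the induction: the letters already met go below [c], and the images of the
    parameters to come form a restricted growth string from [c]. Each new parameter of [s] consumes
    the head of that string. *)
Lemma rg_map (f : nat -> nat) b m c e s :
    (forall i, i < b -> f i < c) -> rg c e (map f (iota b m)) ->
  rg b (b + m) s -> rg c e (map f s).
Proof.
elim: s b m c => [|x s IH] b m c fb /=.
  by case: m => [|m] //; rewrite -[X in X == _]addn0 eqn_add2l.
case: (x =P b) => [->|_] rm; last first.
  by case/andP=> /fb fx rs; rewrite (ltn_eqF fx) fx (IH b m).
case: m rm => [|m] rm; first by rewrite addn0 => /rg_leq; rewrite ltnn.
rewrite addnS -addSn => rs; move: rm => /=; case: (f b =P c) => [fbc|_] rm.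
  by apply: IH rm rs => i; rewrite ltnS leq_eqVlt => /orP[/eqP->|/fb]; lia.
case/andP: rm => fbc rm; rewrite fbc.
by apply: IH rm rs => i; rewrite ltnS leq_eqVlt => /orP[/eqP->|/fb].
Qed.

Lemma letter_subst_lt a G i : i < a -> letter_subst a G i = i.
Proof. by rewrite /letter_subst => ->. Qed.

Lemma map_letter_subst_iota a G : map (letter_subst a G) (iota a (size G)) = G.
Proof.
apply: (@eq_from_nth _ 0) => [|i]; rewrite size_map size_iota // => ilt.
rewrite (nth_map 0) ?size_iota // nth_iota // /letter_subst.
by rewrite ltnNge leq_addr addKn.
Qed.

Lemma size_wcomp a F G : size (wcomp a F G) = size F.
Proof. exact: size_map. Qed.

Lemma rg_wcomp a c F G :
  rg a (a + size G) F -> rg a c G -> rg a c (wcomp a F G).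
Proof.
move=> rF rG; apply: rg_map rF; last by rewrite map_letter_subst_iota.
by move=> i ia; rewrite letter_subst_lt.
Qed.

Lemma wcomp_assoc a F G H : rg a (a + size G) F ->
  wcomp a (wcomp a F G) H = wcomp a F (wcomp a G H).
Proof.
move=> rF; rewrite /wcomp -map_comp; apply/eq_in_map => x xF /=.
rewrite /letter_subst; case: (ltnP x a) => [-> //|ax].
by rewrite (nth_map 0) //; have := rg_lt rF xF; lia.
Qed.

Lemma rg_bump a m s : rg a (a + m) s -> rg a.+1 (a.+1 + m) (map (bump a) s).
Proof.
move=> rs; apply: rg_map rs; first by move=> i; rewrite /bump; lia.
suff -> : map (bump a) (iota a m) = iota a.+1 m by apply: rg_iota.
rewrite -[a.+1]add1n iotaDl; apply/eq_in_map => i.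
by rewrite mem_iota /bump => /andP[-> _].
Qed.

Lemma letter_subst_bump a b G i : letter_subst a (b :: G) (bump a i) = letter_subst a G i.
Proof.
rewrite /letter_subst /bump; case: (ltnP i a) => ia; first by rewrite add0n ia.
by rewrite add1n ltnNge (leqW ia) subSn.
Qed.

Lemma wcomp_bump a b F G : wcomp a (map (bump a) F) (b :: G) = wcomp a F G.
Proof. by rewrite /wcomp -map_comp; apply: eq_map => i; apply: letter_subst_bump. Qed.

Lemma wcomp_var a F G : wcomp a F (a :: G) = wcomp a.+1 F G.
Proof.
apply: eq_map => i; rewrite /letter_subst ltnS; case: (ltngtP i a) => [//|ia|->].
  by rewrite -(subnSK ia).
by rewrite subnn.
Qed.

(** Since [bump a] skips [a], the only [a] in the inner composite comes from the letter [a] of [F2];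
    putting [b] for it commutes with substituting [F1]. *)
Lemma wcomp_letter a b F1 F2 G : b < a -> rg a.+1 (a.+1 + size F1) F2 ->
  wcomp a (wcomp a.+1 F2 (map (bump a) F1)) (b :: G) =
  wcomp a F2 (b :: wcomp a F1 G).
Proof.
move=> ba rF; rewrite /wcomp -map_comp; apply/eq_in_map => y yF /=.
have ylt := rg_lt rF yF.
rewrite {2}/letter_subst ltnS; case: (ltngtP y a) => [ya|ay|->].
- by rewrite !letter_subst_lt.
- rewrite (nth_map 0); last by lia.
  rewrite letter_subst_bump [in RHS]/letter_subst ltnNge (ltnW ay) /=.
  by rewrite -[y - a]prednK ?subn_gt0 //= -subnS (nth_map 0) //; lia.
by rewrite /letter_subst ltnn subnn.
Qed.

Lemma words_rg a n u : (u \in words a n) = (size u == n) && rg a a u.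
Proof.
elim: n u => [|n IH] [|b u] //=; last 2 first.
- by apply/negP => /allpairsP[[? ?] []].
- rewrite eqSS; apply/allpairsP/idP.
    case=> -[x w] /= [xa wn [-> ->]]; move: xa wn; rewrite mem_iota /= IH.
    by move=> xa /andP[-> ->]; rewrite (ltn_eqF xa) xa.
  case: (b =P a) => [_ /andP[_ /rg_leq]|_ /and3P[su ba ru]]; first by rewrite ltnn.
  by exists (b, u); rewrite mem_iota IH su ru.
by rewrite inE !eqxx.
Qed.

Lemma mem_words a n u : size u = n -> rg a a u -> u \in words a n.
Proof. by rewrite words_rg => -> ->; rewrite eqxx. Qed.

(** * First occurrences of parameters *)

Lemma before_rg b e s y : rg b e s -> b <= y < e ->
  (y \in s) /\ {in before y s, forall x, x < y}.
Proof.
rewrite /before; elim: s b => [|x s IH] b /= rs /andP[ly ye].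
  by move/eqP: rs; lia.
move: rs; rewrite inE; case: (x =P b) => [->|_].
  case: (ltngtP b y) ly => [lby|//|->] _ rs; last by [].
  have [|ys IHs] := IH _ rs; first by rewrite lby.
  split=> // z /=; rewrite inE => /predU1P[->|] //.
  exact: IHs.
case/andP=> xb rs; have [|ys IHs] := IH _ rs; first by rewrite ly.
have xy : x < y by apply: leq_trans ly.
rewrite (ltn_eqF xy) ys orbT; split=> // z /=; rewrite inE => /predU1P[->|] //.
exact: IHs.
Qed.

Lemma before_notin y s : y \notin s -> before y s = s.
Proof. by rewrite /before => /memNindex->; rewrite take_size. Qed.

Lemma size_before y s : size (before y s) = index y s.
Proof. by rewrite /before size_take_min (minn_idPl (index_size _ _)). Qed.

Lemma before_words b e s : rg b e s -> b < e ->
  before b s \in words b (index b s).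
Proof.
move=> rs be; have [|_ lt_b] := before_rg rs (y := b); first by rewrite leqnn.
apply: mem_words; first exact: size_before.
elim: (before b s) lt_b => //= x t IH lt_b.
have xb : x < b by apply: lt_b; rewrite inE eqxx.
by rewrite (ltn_eqF xb) xb IH // => z zt; apply: lt_b; rewrite inE zt orbT.
Qed.

(** The letters of [W] before the parameter [a + index a G] become letters below [a]: they are
    fixed, or replaced by letters of [G] preceding its first [a]. *)
Lemma before_wcomp a b W G :
    rg a (a + size G) W -> rg a b G -> a < b ->
  [/\ index a (wcomp a W G) = index (a + index a G) W &
      before a (wcomp a W G) = wcomp a (before (a + index a G) W) (before a G)].
Proof.
move=> rW rG ab; set p := index a G.
have [|aG G_lt] := before_rg rG (y := a); first by rewrite leqnn.
have plt : p < size G by rewrite /p index_mem.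
have [|pW W_lt] := before_rg rW (y := a + p).
  by rewrite leq_addr ltn_add2l.
have eq_before : wcomp a (before (a + p) W) G
               = wcomp a (before (a + p) W) (before a G).
  apply/eq_in_map => x /W_lt; rewrite /letter_subst; case: (ltnP x a) => // ax xlt.
  by rewrite /before -/p nth_take //; lia.
have comp_notin : a \notin wcomp a (before (a + p) W) G.
  rewrite eq_before; apply/mapP => -[x /W_lt xlt]; rewrite /letter_subst.
  case: (ltnP x a) => [xa|ax] e; first by rewrite -e ltnn in xa.
  have : nth 0 (before a G) (x - a) < a.
    by apply: G_lt; rewrite mem_nth // size_before -/p; lia.
  by rewrite -e ltnn.
have defW : W = before (a + p) W ++ (a + p) :: drop (index (a + p) W).+1 W.
  rewrite -{1}(cat_take_drop (index (a + p) W) W); congr (_ ++ _).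
  by rewrite (drop_nth 0) ?index_mem // nth_index.
have defWG : wcomp a W G = wcomp a (before (a + p) W) G
                          ++ a :: wcomp a (drop (index (a + p) W).+1 W) G.
  rewrite {1}defW /wcomp map_cat /=; congr (_ ++ _ :: _).
  by rewrite /letter_subst ltnNge leq_addr addKn nth_index.
have iWG : index a (wcomp a W G) = index (a + p) W.
  by rewrite defWG index_cat (negPf comp_notin) /= eqxx addn0 size_wcomp size_before.
split=> //; rewrite -eq_before /before iWG defWG.
by rewrite take_size_cat // size_wcomp size_before.
Qed.

(** Recovers the recursive definition from the order of first occurrences, the form in which
    positivity supplies rigidity. *)
Lemma rg_first_occurrences c b s :
    c <= b -> {in s, forall x, x < b} -> (forall y, c <= y < b -> y \in s) ->
    (forall y' y, c <= y' -> y' < y -> y < b -> index y' s < index y s) ->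
  rg c b s.
Proof.
elim: s c => [|x s IH] c cb s_lt s_occ s_ord /=.
  by case: (ltngtP c b) cb => // ltcb _; have := s_occ c; rewrite leqnn ltcb => /(_ isT).
have s_lt' : {in s, forall z, z < b} by move=> z zs; apply: s_lt; rewrite inE zs orbT.
have ind c' : c <= c' -> c' <= b -> x < c' -> rg c' b s.
  move=> cc' c'b xc'; apply: IH => // [y /andP[c'y yb]|y' y c'y' ltyy' yb].
    have := s_occ y; rewrite (leq_trans cc' c'y) yb inE => /(_ isT).
    by rewrite gtn_eqF // (leq_trans xc').
  have := s_ord y' y (leq_trans cc' c'y') ltyy' yb.
  by rewrite /= !ltn_eqF // (leq_trans xc') // ltnW // (leq_ltn_trans c'y').
have xb : x < b by apply: s_lt; rewrite inE eqxx.
case: (ltngtP x c) => [xc|cx|xc]; first by apply: ind.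
  have := s_ord c x (leqnn c) cx xb; rewrite /= eqxx.
  by case: ifP.
by apply: ind; rewrite -?xc.
Qed.

Lemma rg_index_lt b s y' y : rg 0 b s -> y' < y -> y < b -> index y' s < index y s.
Proof.
move=> rs lty yb; have [|y's lt_y'] := before_rg rs (y := y').
  by rewrite /= (ltn_trans lty).
have [|ys _] := before_rg rs (y := y); first by [].
case: (ltngtP (index y' s) (index y s)) => // [lti|eqi].
  have : y \in before y' s.
    by rewrite /before -{1}(nth_index 0 ys) -(nth_take 0 lti) mem_nth // size_before.
  by move/lt_y'; rewrite ltnNge ltnW.
by move: lty; rewrite -(nth_index 0 ys) -eqi nth_index // ltnn.
Qed.

(** A product colouring: one colour of [t] records [c u t] for all [u] in [X]. [C'] depends on [X]
    and [C] only, so it is available before the colouring is given. *)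
Lemma vector_coloring (X : seq (seq nat)) (C : finType) :
  exists C' : finType, forall c : seq nat -> seq nat -> C,
  exists (c' : seq nat -> C') (dec : seq nat -> C' -> C),
    forall t, {in X, forall u, c u t = dec u (c' t)}.
Proof.
exists ((size X).-tuple C) => c.
exists (fun t => map_tuple (c^~ t) (in_tuple X)).
exists (fun (u : seq nat) (v : (size X).-tuple C) => nth (c [::] [::]) v (index u X)) => t u uX /=.
by rewrite (nth_map [::]) ?index_mem // nth_index.
Qed.

(** * The Hales-Jewett theorem *)

(** A combinatorial line whose colour is constant only between letters related by [E]. The full
    relation gives Hales-Jewett; identifying two letters gives Shelah's lemma. *)
Definition line_property (a : nat) (E : rel nat) : Prop :=
  forall C : finType, exists n, forall c : seq nat -> C,
  exists l, [/\ size l = n, rg a a.+1 l &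
    forall b b', b < a -> b' < a -> E b b' -> c (wcomp a l [:: b]) = c (wcomp a l [:: b'])].

Lemma wcomp_line a l b t : rg a a.+1 l -> wcomp a l (b :: t) = wcomp a l [:: b].
Proof.
move=> rl; apply/eq_in_map => x /(rg_lt rl); rewrite ltnS /letter_subst.
by case: ltngtP => // -> _; rewrite subnn.
Qed.

Lemma wcomp_line_bump a l b : rg a a.+1 l ->
  wcomp a.+1 (map (bump a) l) [:: b] = wcomp a l [:: b].
Proof.
move=> rl; rewrite /wcomp -map_comp; apply/eq_in_map => x /(rg_lt rl) /=.
rewrite ltnS leq_eqVlt /letter_subst /bump => /orP[/eqP->|xa].
  by rewrite leqnn add1n !ltnn !subnn.
by rewrite (leqNgt a) xa ltnS (ltnW xa).
Qed.

(** [Q] lines are concatenated, each with its own parameter. All the initial segments are treated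
    together because the Graham-Rothschild induction colours prefixes. *)
Lemma line_property_product a E : line_property a E ->
  forall (Q : nat) (C : finType), exists n, forall c : seq nat -> C,
  exists F, [/\ size F = n, rg a (a + Q) F &
    forall q, q <= Q -> {in words a q &, forall u u', all2 E u u' ->
      c (wcomp a (before (a + q) F) u) = c (wcomp a (before (a + q) F) u')}].
Proof.
move=> lineE; elim=> [|Q IH] C.
  by exists 0 => c; exists [::]; split; rewrite //= addn0.
(* The length [n0] of the head line is fixed from colour vectors over all tails of length at most
   [Q]; the tail space is then chosen for colour vectors over all heads of length [n0]. *)
have [C0 vec0] := vector_coloring (flatten [seq words a q | q <- iota 0 Q.+1]) C.
have [n0 line0] := lineE C0.
have [C1 vec1] := vector_coloring (words a n0) C.
have [n1 IHn] := IH C1; exists (n0 + n1) => c.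
have [c1 [dec1 c1P]] := vec1 (fun u t => c (u ++ t)).
have [F1 [sF1 rF1 F1P]] := IHn c1.
have [c0 [dec0 c0P]] := vec0 (fun t u => c (u ++ wcomp a (before (a + size t) F1) t)).
have [l [sl rl lP]] := line0 c0.
exists (l ++ map (bump a) F1); split.
- by rewrite size_cat size_map sl sF1.
- by rewrite addnS -addSn; apply: rg_cat rl (rg_bump rF1).
case=> [|q] ltqQ u u'.
  by rewrite !words_rg => /andP[/nilP-> _] /andP[/nilP-> _].
have -> : before (a + q.+1) (l ++ map (bump a) F1)
        = l ++ map (bump a) (before (a + q) F1).
  have -> : a + q.+1 = bump a (a + q) by rewrite /bump leq_addr addnS.
  rewrite /before index_cat ifN; last first.
    by apply/negP => /(rg_lt rl); rewrite /bump leq_addr; lia.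
  rewrite index_map; last exact: can_inj (bumpK _).
  by rewrite take_cat ltnNge leq_addr addKn map_take.
rewrite !words_rg; case: u => // b t; case: u' => // b' t' /=.
rewrite !eqSS => /andP[st rt] /andP[st' rt'] /andP[Eb Et].
have lt_head x s : (if x == a then rg a.+1 a s else (x < a) && rg a a s) ->
  (x < a) /\ rg a a s.
  by case: eqP => [_ /rg_leq|_ /andP[]]; rewrite ?ltnn.
have [ba {}rt] := lt_head _ _ rt; have [ba' {}rt'] := lt_head _ _ rt'.
have comp_cat_line x s : wcomp a (l ++ map (bump a) (before (a + q) F1)) (x :: s)
    = wcomp a l [:: x] ++ wcomp a (before (a + q) F1) s.
  by rewrite {1}/wcomp map_cat -/(wcomp _ _ _) -/(wcomp _ _ _) wcomp_line // wcomp_bump.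
have tw : t \in words a q by apply/mem_words => //; apply/eqP.
have tw' : t' \in words a q by apply/mem_words => //; apply/eqP.
rewrite !comp_cat_line.
transitivity (c (wcomp a l [:: b'] ++ wcomp a (before (a + q) F1) t)).
  have tX : t \in flatten [seq words a q0 | q0 <- iota 0 Q.+1].
    apply/flattenP; exists (words a q) => //.
    by apply: map_f; rewrite mem_iota.
  have := c0P (wcomp a l [:: b]) t tX; have := c0P (wcomp a l [:: b']) t tX.
  by rewrite /= (eqP st) (lP b b') // => -> ->.
have lw : wcomp a l [:: b'] \in words a n0.
  apply: mem_words; first by rewrite size_wcomp.
  apply: rg_wcomp; first by rewrite addn1.
  by rewrite /= (ltn_eqF ba') ba' eqxx.
by rewrite (c1P _ _ lw) (c1P _ _ lw) (F1P q ltqQ t t').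
Qed.

(* Shelah: the words [a^i (a+1)^(n-i)], [i <= n], cannot all get distinct
   colours when [n >= #|C|]. *)
Lemma shelah_line a : line_property a.+2 (fun b b' => minn b a == minn b' a).
Proof.
move=> C; exists #|C| => c; set n := #|C|.
pose w i := nseq i a ++ nseq (n - i) a.+1.
have /injectivePn[i0 [j0 neq_ij0 eq_c]] : ~~ injectiveb (fun i : 'I_n.+1 => c (w i)).
  apply/injectiveP => inj_c; have := leq_card _ inj_c.
  by rewrite card_ord ltnn.
have {neq_ij0 eq_c} [i [j [ij jn eq_c]]] :
    exists i j, [/\ i < j, j <= n & c (w i) = c (w j)].
  case: (ltngtP i0 j0) => [ltij|ltji|/val_inj eqij].
  - by exists i0, j0; split; rewrite // -ltnS ltn_ord.
  - by exists j0, i0; split; rewrite // -ltnS ltn_ord.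
  by rewrite eqij eqxx in neq_ij0.
(* Putting [a] for the parameter gives [w j], putting [a + 1] gives [w i]. *)
exists (nseq i a ++ nseq (j - i) a.+2 ++ nseq (n - j) a.+1); split.
- by rewrite !size_cat !size_nseq; lia.
- apply: (@rg_cat _ a.+2); first by rewrite rg_nseq.
  apply: (@rg_cat _ a.+3); last by rewrite rg_nseq.
  by rewrite -[j - i]prednK ?subn_gt0 //= eqxx rg_nseq.
have inst b : wcomp a.+2 (nseq i a ++ nseq (j - i) a.+2 ++ nseq (n - j) a.+1) [:: b]
    = nseq i a ++ nseq (j - i) b ++ nseq (n - j) a.+1.
  rewrite /wcomp !map_cat !map_nseq /letter_subst !leqnn ltnn subnn /=.
  by rewrite leqnSn.
have wj : nseq i a ++ nseq (j - i) a ++ nseq (n - j) a.+1 = w j.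
  by rewrite catA -nseqD subnKC // ltnW.
have wi : nseq i a ++ nseq (j - i) a.+1 ++ nseq (n - j) a.+1 = w i.
  by rewrite -nseqD /w; congr (_ ++ nseq _ _); lia.
move=> b b' lt_b lt_b' /eqP Eb.
have [->//|[[-> ->]|[-> ->]]] : b = b' \/ (b = a /\ b' = a.+1) \/ (b = a.+1 /\ b' = a).
- by lia.
- by rewrite !inst wi wj.
by rewrite !inst wi wj.
Qed.

(* Induction on the alphabet: in the cube provided by [shelah_line] the letters
   [a] and [a + 1] can be exchanged without changing the colour. *)
Theorem hales_jewett a : line_property a (fun _ _ => true).
Proof.
case: a => [|a]; first by move=> C; exists 1 => c; exists [:: 0].
elim: a => [|a IH] C.
  by exists 1 => c; exists [:: 1]; split=> // -[|b] [|b'].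
(* [h] is the line length for [a + 1] letters. The line [l] is found inside the [h]-dimensional cube
   [F] over [a + 2] letters, and [bump] renames its parameter to [a + 2]. *)
have [h IHh] := IH C.
have [n prod_n] := line_property_product (shelah_line a) h C; exists n => c.
have [F [sF rF FP]] := prod_n c.
have [l [sl rl lP]] := IHh (fun u => c (wcomp a.+2 F u)).
have sl' : size (map (bump a.+1) l) = h by rewrite size_map.
have rl' : rg a.+2 a.+3 (map (bump a.+1) l).
  by have := @rg_bump a.+1 1 l; rewrite !addn1; apply.
exists (wcomp a.+2 F (map (bump a.+1) l)); split.
- by rewrite size_wcomp.
- by apply: rg_wcomp => //; rewrite sl'.
have instE b : wcomp a.+2 (wcomp a.+2 F (map (bump a.+1) l)) [:: b]
             = wcomp a.+2 F (wcomp a.+1 l [:: b]).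
  by rewrite wcomp_assoc ?sl' // wcomp_line_bump.
have beforeF : before (a.+2 + h) F = F.
  by apply: before_notin; apply/negP => /(rg_lt rF); rewrite ltnn.
have rgb b : b < a.+2 -> wcomp a.+1 l [:: b] \in words a.+2 h.
  move=> lt_b; apply: mem_words; first by rewrite size_wcomp.
  have : rg a.+2 a.+2 (wcomp a.+2 (map (bump a.+1) l) [:: b]).
    apply: rg_wcomp; first by rewrite addn1.
    by rewrite /= (ltn_eqF lt_b) lt_b eqxx.
  by rewrite wcomp_line_bump.
(* [minn b a] merges the letter [a + 1] into [a], landing in the alphabet on which [l] is
   monochromatic. *)
have retract b : b < a.+2 ->
    c (wcomp a.+2 F (wcomp a.+1 l [:: b])) = c (wcomp a.+2 F (wcomp a.+1 l [:: minn b a])).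
  move=> lt_b; have := FP h (leqnn h) _ _ (rgb _ lt_b) (rgb (minn b a) _).
  rewrite beforeF; apply; first by lia.
  rewrite /wcomp; elim: (l) => //= x s ->; rewrite andbT /letter_subst.
  by case: ifP => // _; case: (x - a.+1) => [|[]] //=; apply/eqP; lia.
move=> b b' lt_b lt_b' _; rewrite !instE retract // (retract b') //.
by apply: lP => //; lia.
Qed.

(** * The Graham-Rothschild theorem *)

Lemma constant_on (X : seq (seq nat)) (C : eqType) (c : seq nat -> C) :
  {in X &, forall u v, c u = c v} -> exists d, {in X, forall u, c u = d}.
Proof.
case: X => [|x X] cP; first by exists (c [::]).
by exists (c x) => u uX; apply: cP => //; rewrite inE eqxx.
Qed.

(** [F] is an [m]-parameter word and the [wcomp a F G] are its [k]-parameter subwords. For [a = 0]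
    these are rigid surjections onto [k]. *)
Definition graham_rothschild_property (k : nat) : Prop :=
  forall (a m : nat) (C : finType), exists n, forall c : seq nat -> C,
  exists F d, [/\ size F = n, rg a (a + m) F &
    forall G, size G = m -> rg a (a + k) G -> c (wcomp a F G) = d].

Lemma graham_rothschild0 : graham_rothschild_property 0.
Proof.
move=> a m C; have [n prod_n] := line_property_product (@hales_jewett a) m C.
exists n => c; have [F [sF rF FP]] := prod_n c.
have beforeF : before (a + m) F = F.
  by apply: before_notin; apply/negP => /(rg_lt rF); rewrite ltnn.
have [|d dP] := @constant_on (words a m) _ (fun u => c (wcomp a F u)).
  move=> u u' uw uw'; have := FP m (leqnn m) u u' uw uw'; rewrite beforeF; apply.
  move: uw uw'; rewrite !words_rg => /andP[/eqP su _] /andP[/eqP su' _].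
  move: su'; rewrite -{}su; elim: u u' => [|x u IHu] [|x' u'] //= [].
  exact: IHu.
exists F, d; split=> // G sG; rewrite addn0 => rG.
by apply: dP; apply: mem_words.
Qed.

(** The first coordinate of the word built is the parameter [a]. Subwords that begin with a
    parameter are made monochromatic by [F2], whose extra letter [a] stands for that parameter;
    those that begin with a letter [b] are left to the induction on [m], which yields [F1] for all
    [b] at once. *)
Lemma end_homogeneous k : graham_rothschild_property k ->
  forall (a m : nat) (C : finType), exists n, forall c : seq nat -> C,
  exists F (e : seq nat -> C), [/\ size F = n, rg a (a + m) F &
    forall G, size G = m -> rg a (a + k.+1) G -> c (wcomp a F G) = e (before a G)].
Proof.
move=> GRk a; elim=> [|m IH] C.
  exists 0 => c; exists [::], (fun=> c [::]); split=> //.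
  by rewrite /= addn0.
have [C1 vec1] := vector_coloring (words a 1) C.
have [n1 IHn] := IH C1.
have [n2 GRn] := GRk a.+1 n1 C; exists n2.+1 => c.
have [F2 [d [sF2 rF2 F2P]]] := GRn (fun T => c (a :: T)).
(* The letter goes in front and also for the letter [a] of [F2], both being the same parameter of
   the final word. *)
have [c1 [dec c1P]] := vec1 (fun b T => c (b ++ wcomp a F2 (b ++ T))).
have [F1 [e [sF1 rF1 F1P]]] := IHn c1.
have rF1' := rg_bump rF1; have sF1' : size (map (bump a) F1) = n1 by rewrite size_map.
exists (a :: wcomp a.+1 F2 (map (bump a) F1)).
exists (fun u => if u is b :: u' then dec [:: b] (e u') else d); split.
- by rewrite /= size_wcomp sF2.
- by rewrite /= eqxx addnS -addSn; apply: rg_wcomp => //; rewrite sF1'.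
case=> // b G [sG] /=; rewrite /before /=; case: (b =P a) => [->|/eqP neq_ba].
  rewrite addnS -addSn => rG /=; rewrite -/(wcomp _ _ _) wcomp_var.
  rewrite {1}/letter_subst ltnn subnn /=.
  rewrite wcomp_assoc ?sF1' // F2P ?size_wcomp //.
  by apply: rg_wcomp => //; rewrite sG.
case/andP=> ba rG; rewrite -/(wcomp _ _ _) wcomp_letter ?sF1 //.
rewrite {1}/letter_subst ltnn subnn /=.
have bw : [:: b] \in words a 1 by apply: mem_words; rewrite //= (negPf neq_ba) ba eqxx.
by have /= := c1P (wcomp a F1 G) _ bw => ->; rewrite F1P.
Qed.

(** The parameters go to the first [m] positions satisfying [P]; all other positions get the letter
    [0], available because [0 < b]. *)
Lemma select_letters (P : pred nat) (N m b i : nat) :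
    0 < b -> m <= count P (iota i N) ->
  exists H, [/\ size H = N, rg b (b + m) H &
    forall p, p < m -> P (i + index (b + p) H)].
Proof.
elim: N m b i => [|N IH] m b i b0 /=.
  by rewrite leqn0 => /eqP->; exists [::]; rewrite /= addn0.
case: m => [|m].
  move=> _; exists (nseq N.+1 0); rewrite size_nseq addn0; split=> //.
  exact: rg_nseq.
case Pi: (P i) => /=; rewrite ?add1n ?add0n ?ltnS => lem.
  have [H [sH rH HP]] := IH m b.+1 i.+1 isT lem.
  exists (b :: H); split; first by rewrite /= sH.
    by rewrite /= eqxx addnS -addSn.
  case=> [|p] lt_p /=; first by rewrite addn0 eqxx addn0.
  by rewrite ifN ?addnS -?addSn ?HP //; lia.
have [H [sH rH HP]] := IH m.+1 b i.+1 b0 lem.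
exists (0 :: H); split; first by rewrite /= sH.
  by rewrite /= b0 rH (ltn_eqF b0).
move=> p lt_p /=; rewrite ifN; last by lia.
by rewrite addnS -addSn HP.
Qed.

Lemma pigeonhole_letters (C : finType) (d : nat -> C) (m a : nat) : 0 < a ->
  exists H j, [/\ size H = #|C| * m, rg a (a + m) H &
    forall p, p < m -> d (index (a + p) H) = j].
Proof.
move=> a0; pose cnt j := count (fun i => d i == j) (iota 0 (#|C| * m)).
have [j mj] : exists j, m <= cnt j.
  apply/existsP; case: (boolP [exists j, m <= cnt j]) => //.
  rewrite negb_exists => /forallP cnt_lt; exfalso.
  have m0 : 0 < m by have := cnt_lt (d 0); rewrite -ltnNge; case: (m).
  have C0 : 0 < #|C| by apply/card_gt0P; exists (d 0).
  have: \sum_(j : C) cnt j <= #|C| * m.-1.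
    rewrite -sum_nat_const; apply: leq_sum => j _.
    by have := cnt_lt j; rewrite -ltnNge; lia.
  have -> : \sum_(j : C) cnt j = #|C| * m.
    rewrite /cnt -[RHS](size_iota 0); elim: (iota _ _) => [|i s IHs] /=.
      by rewrite big1.
    rewrite big_split /= IHs (bigD1 (d i)) //= eqxx big1 // => j.
    by rewrite eq_sym => /negPf->.
  by rewrite leq_pmul2l //; lia.
have [H [sH rH HP]] := select_letters a0 mj.
by exists H, j; split=> // p /HP /eqP; rewrite add0n.
Qed.

(** For a nonempty alphabet the dependence of the colour is removed in three stages: [F1] leaves
    only the prefix before the first parameter, [F2] only the length of the prefix substituted into
    it, and [H] keeps only lengths of one colour. *)
Theorem graham_rothschild k : graham_rothschild_property k.
Proof.
elim: k => [|k GRk]; first exact: graham_rothschild0.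
case=> [|a] m C.
  (* Over the empty alphabet a word begins with a parameter, so the prefix is empty and
     end-homogeneity suffices. *)
  have [n nP] := end_homogeneous GRk 0 m C; exists n => c.
  have [F [e [sF rF FP]]] := nP c; exists F, (e [::]); split=> // G sG rG.
  rewrite FP //; congr (e _); move: rG; case: G {sG} => //= x G.
  by case: eqP => [->|] //; rewrite /before /=.
move: a.+1 (ltn0Sn a) => {}a a0.
have [M prodM] := line_property_product (@hales_jewett a) (#|C| * m) C.
have [n nP] := end_homogeneous GRk a M C; exists n => c.
have [F1 [e [sF1 rF1 F1P]]] := nP c.
have [F2 [sF2 rF2 F2P]] := prodM e.
(* [nseq q 0] is a sample word of length [q]; by [F2P] it has the colour of every such word. *)
have [H [j [sH rH HP]]] := pigeonhole_letters
  (fun q => e (wcomp a (before (a + q) F2) (nseq q 0))) m a0.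
have rF21 : rg a (a + size H) F2 by rewrite sH.
have rF2H : rg a (a + m) (wcomp a F2 H) by apply: rg_wcomp.
exists (wcomp a F1 (wcomp a F2 H)), j; split.
- by rewrite size_wcomp.
- by apply: rg_wcomp => //; rewrite size_wcomp sF2.
move=> G sG rG; have lt_ak : a < a + k.+1 by lia.
have rHG : rg a (a + k.+1) (wcomp a H G) by apply: rg_wcomp; rewrite ?sG.
rewrite wcomp_assoc ?size_wcomp ?sF2 // F1P ?size_wcomp //; last first.
  by apply: rg_wcomp; rewrite ?sG.
rewrite wcomp_assoc //.
have rF2HG : rg a (a + size (wcomp a H G)) F2 by rewrite size_wcomp.
have rHsG : rg a (a + size G) H by rewrite sG.
have [_ ->] := before_wcomp rF2HG rHG lt_ak.
have uw := before_words rHG lt_ak; move: uw.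
have [-> _] := before_wcomp rHsG rG lt_ak => uw.
have [|aG _] := before_rg rG (y := a); first by rewrite leqnn.
have lt_p : index a G < m by rewrite -sG index_mem aG.
rewrite -(HP _ lt_p); apply: F2P => //.
- have [|pH _] := before_rg rH (y := a + index a G).
    by rewrite leq_addr ltn_add2l.
  by rewrite -sH ltnW // index_mem.
- by apply: mem_words; rewrite ?size_nseq ?rg_nseq.
move: uw; rewrite words_rg => /andP[/eqP su _]; move: su; move: (before _ _) => u <-.
by elim: u.
Qed.

(** * Finite distributive lattices with a natural order *)

Import Order.TTheory.
Local Open Scope order_scope.

Section JoinIrreducibles.
Context {d : Order.disp_t} {L : finTBDistrLatticeType d}.
Implicit Types x y z j : L.

Lemma finlattice_ind (P : L -> Prop) :
  (forall x, (forall y, y < x -> P y) -> P x) -> forall x, P x.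
Proof.
move=> IH x; have [n] := ubnP #|[set z | z <= x]|.
elim: n x => // n IHn x; rewrite ltnS => xn; apply: IH => y ltyx.
apply: IHn; apply: leq_trans xn; apply: proper_card; apply/properP; split.
  by apply/subsetP => z; rewrite !inE => /le_trans; apply; apply: ltW.
by exists x; rewrite !inE ?lexx // (lt_geF ltyx).
Qed.

(** Distributivity makes join-irreducibles join-prime: below a join, [j] is the join of its meets
    with [y] and [z], hence equals one of them. *)
Lemma join_irreducible_leU j y z : join_irreducible j ->
  (j <= y `|` z) = (j <= y) || (j <= z).
Proof.
case/andP=> _ /forallP/(_ (j `&` y))/forallP/(_ (j `&` z)) jP.
apply/idP/orP => [|[] jle]; last 2 first.
- by rewrite (le_trans jle) ?leUl.
- by rewrite (le_trans jle) ?leUr.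
move=> /meet_idPl; rewrite meetUr => jE; move: jP; rewrite jE eqxx /=.
by case/orP=> /eqP e; [left | right]; rewrite e leIr.
Qed.

Lemma join_irreducible_le0 j : join_irreducible j -> (j <= \bot) = false.
Proof. by case/andP=> j0 _; rewrite lex0 (negPf j0). Qed.

Lemma join_irreducible_le_joins (I : finType) (P : {pred I}) (F : I -> L) j :
  join_irreducible j -> j <= \join_(i | P i) F i -> exists2 i, P i & j <= F i.
Proof.
move=> ji_j; elim/big_rec: _ => [|i x Pi IH]; first by rewrite join_irreducible_le0.
by rewrite join_irreducible_leU // => /orP[|//]; exists i.
Qed.

Lemma le_join_irreducible x y :
  (forall j, join_irreducible j -> j <= x -> j <= y) -> x <= y.
Proof.
elim/finlattice_ind: x => x IH xy; case ji_x: (join_irreducible x); first exact: xy.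
move/negbT: ji_x; rewrite negb_and negbK => /orP[/eqP->|]; first exact: le0x.
rewrite negb_forall => /existsP[u]; rewrite negb_forall => /existsP[v].
rewrite negb_imply negb_or => /and3P[/eqP xuv neq_xu neq_xv].
rewrite xuv leUx !IH //.
- by rewrite lt_neqAle eq_sym neq_xv xuv leUr.
- by move=> j ji_j jv; apply: xy => //; rewrite xuv (le_trans jv) ?leUr.
- by rewrite lt_neqAle eq_sym neq_xu xuv leUl.
by move=> j ji_j ju; apply: xy => //; rewrite xuv (le_trans ju) ?leUl.
Qed.

Lemma eq_join_irreducible x y :
  (forall j, join_irreducible j -> (j <= x) = (j <= y)) -> x = y.
Proof.
by move=> xy; apply: le_anti; apply/andP; split; apply: le_join_irreducible => j /xy->.
Qed.

Lemma joins_join_irreducible x : \join_(j | join_irreducible j && (j <= x)) j = x.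
Proof.
apply: eq_join_irreducible => p ji_p; apply/idP/idP => [|px].
  by case/(join_irreducible_le_joins ji_p) => j /andP[_ jx] pj; apply: le_trans pj jx.
by apply: joins_sup; rewrite ji_p px.
Qed.

Lemma le_diff_joinP x (S : {set L}) p : join_irreducible p ->
  reflect (exists j, [/\ join_irreducible j, j <= x, j \notin S & p <= j])
          (p <= diff_join x S).
Proof.
move=> ji_p; apply: (iffP idP) => [|[j [ji_j jx jS pj]]].
  by case/(join_irreducible_le_joins ji_p) => j /and3P[? ? ?] ?; exists j.
by apply: le_trans pj _; apply: joins_sup; rewrite ji_j jx.
Qed.

Lemma diff_join_le x (S : {set L}) : diff_join x S <= x.
Proof. by apply/joinsP => j /and3P[]. Qed.

(** * The antilexicographic order *)

Section Antilex.
Variables (r : rel L) (hr : linear_extension r).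

Lemma antilexP x y :
  reflect (exists s, [/\ join_irreducible s, ~~ (s <= x), s <= y &
             forall t, join_irreducible t -> r s t -> (t <= x) = (t <= y)])
          (antilex r x y).
Proof.
have deltaE s u v : (delta s u == delta s v) = ((s <= u) == (s <= v)).
  by rewrite /delta; do 2!case: (_ <= _).
apply: (iffP existsP) => -[s].
  case/and3P=> ji_s slt /forallP sP; exists s; move: slt; rewrite /delta.
  case sx: (s <= x); case sy: (s <= y) => //= _; split=> // t ji_t st.
  by have := sP t; rewrite [t \in _]ji_t st deltaE => /eqP.
case=> ji_s sx sy sP; exists s; rewrite [s \in _]ji_s /delta (negPf sx) sy /=.
apply/forallP => t; apply/implyP => ji_t; apply/implyP => st.
by rewrite -!/(delta _ _) deltaE sP.
Qed.

Lemma linear_extension_max (A : {pred L}) :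
    (forall a, a \in A -> join_irreducible a) -> (exists a, a \in A) ->
  exists2 s, s \in A & forall t, t \in A -> ~~ r s t.
Proof.
case: hr => rI rT _ _ A_ji [a0 Aa0].
(* The maximum is an element with the most [r]-predecessors in [A]: anything above it would have
   more. *)
case: (arg_maxnP (fun s => #|[set t in A | r t s]|) Aa0) => s As s_max.
have {}As : s \in A by [].
exists s => // t At; apply/negP => st.
have := s_max t At; rewrite /= leqNgt => /negP; apply.
apply: proper_card; apply/properP; split.
  apply/subsetP => u; rewrite !in_set => /andP[Au us]; rewrite Au /=.
  by apply: rT us st; apply: A_ji.
by exists s; rewrite in_set ?As ?st // rI ?andbF //; apply: A_ji.
Qed.

Lemma antilex_irreflexive : irreflexive (antilex r).
Proof.
by move=> x; apply/negbTE/negP => /antilexP[s [_ /negP sx sx']].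
Qed.

Lemma antilex_trans : transitive (antilex r).
Proof.
case: hr => rI rT rtot _ y x z /antilexP[s [ji_s sx sy sP]].
move=> /antilexP[u [ji_u uy uz uP]]; apply/antilexP.
have [eq_su|neq_su] := eqVneq s u; first by rewrite eq_su (negPf uy) in sy.
case/orP: (rtot s u ji_s ji_u neq_su) => [su|us].
  exists u; split=> //; first by rewrite sP.
  by move=> t ji_t ut; rewrite sP ?uP //; apply: rT su ut.
exists s; split=> //; first by rewrite -uP.
by move=> t ji_t st; rewrite sP ?uP //; apply: rT us st.
Qed.

(** The [r]-greatest join-irreducible lying below exactly one of [x] and [y] decides. *)
Lemma antilex_total x y : x != y -> antilex r x y || antilex r y x.
Proof.
move=> neq_xy; pose A : {pred L} := [pred j | join_irreducible j & (j <= x) != (j <= y)].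
have A_ji a : a \in A -> join_irreducible a by case/andP.
have [|s sA s_max] := linear_extension_max A_ji.
  apply/existsP; apply: contraR neq_xy; rewrite negb_exists => /forallP noA.
  apply/eqP/eq_join_irreducible => j ji_j; apply/eqP.
  by have := noA j; rewrite inE ji_j negbK.
have sP t : join_irreducible t -> r s t -> (t <= x) = (t <= y).
  move=> ji_t st; apply/eqP; apply: contraLR st => txy.
  by apply: s_max; rewrite inE ji_t.
case/andP: sA => ji_s; case sx: (s <= x); case sy: (s <= y) => //= _; apply/orP.
  by right; apply/antilexP; exists s; rewrite sx sy; split=> // t ? ?; rewrite sP.
by left; apply/antilexP; exists s; rewrite sx sy.
Qed.

Lemma antilex_lt x y : x < y -> antilex r x y.
Proof.
move=> ltxy; case/orP: (antilex_total (negbT (lt_eqF ltxy))) => //.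
case/antilexP=> s [_ /negP sy sx _]; case: sy.
exact: le_trans sx (ltW ltxy).
Qed.

Lemma linear_extension_asym s t :
  join_irreducible s -> join_irreducible t -> r s t -> ~~ r t s.
Proof.
case: hr => rI rT _ _ ji_s ji_t st; apply/negP => ts.
by have := rT _ _ _ ji_s ji_t ji_t ts st; rewrite rI.
Qed.

Lemma linear_extension_nle s t :
  join_irreducible s -> join_irreducible t -> r s t -> ~~ (t <= s).
Proof.
case: (hr) => rI _ _ rlt ji_s ji_t st; rewrite le_eqVlt negb_or; apply/andP; split.
  by apply: contraTneq st => ->; rewrite rI.
by apply: contraL st => /(rlt _ _ ji_t ji_s); apply: linear_extension_asym.
Qed.

Lemma antilex_join_irreducible s t :
  join_irreducible s -> join_irreducible t -> r s t -> antilex r s t.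
Proof.
move=> ji_s ji_t st; apply/antilexP; exists t; split=> //.
  exact: linear_extension_nle.
case: hr => rI rT _ _ u ji_u tu.
rewrite !(negPf (linear_extension_nle _ _ _)) //.
exact: rT st tu.
Qed.

End Antilex.
End JoinIrreducibles.

(** * The natural order as a chain, with elements replaced by their ranks *)

Section NaturallyOrdered.
Variable L : natOrdLattice.
Implicit Types x y z : L.

Lemma nol_lt_irreflexive : irreflexive (@nol_lt L).
Proof. by have [r hr ltE] := nol_natural L; move=> x; rewrite ltE antilex_irreflexive. Qed.

Lemma nol_lt_trans : transitive (@nol_lt L).
Proof.
have [r hr ltE] := nol_natural L; move=> y x z; rewrite !ltE.
exact: antilex_trans.
Qed.

Lemma nol_lt_total x y : x != y -> nol_lt x y || nol_lt y x.
Proof. by have [r hr ltE] := nol_natural L; rewrite !ltE; apply: antilex_total. Qed.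

Lemma lt_nol_lt x y : x < y -> nol_lt x y.
Proof. by have [r hr ltE] := nol_natural L; rewrite ltE; apply: antilex_lt. Qed.

Lemma nol_leNlt x y : nol_le x y = ~~ nol_lt y x.
Proof.
rewrite /nol_le; case: eqVneq => [->|/nol_lt_total]; first by rewrite nol_lt_irreflexive.
case/orP=> [xy|yx].
  rewrite xy; apply/esym; apply: contraFN (nol_lt_irreflexive x); exact: nol_lt_trans.
by rewrite yx; apply: contraFF (nol_lt_irreflexive x) => /nol_lt_trans; apply.
Qed.

Lemma le_nol_le x y : x <= y -> nol_le x y.
Proof. by rewrite le_eqVlt /nol_le => /orP[->//|/lt_nol_lt->]; rewrite orbT. Qed.

Lemma nol_le_trans : transitive (@nol_le L).
Proof.
move=> y x z /orP[/eqP->//|xy] /orP[/eqP<-|yz]; rewrite /nol_le ?xy ?orbT //.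
by rewrite (nol_lt_trans xy yz) orbT.
Qed.

Definition nol_enum : seq L := sort (@nol_le L) (enum L).

Lemma size_nol_enum : size nol_enum = #|L|.
Proof. by rewrite size_sort cardE. Qed.

Lemma mem_nol_enum x : x \in nol_enum.
Proof. by rewrite mem_sort mem_enum. Qed.

Lemma index_nol_enum x : (index x nol_enum < #|L|)%N.
Proof. by rewrite -size_nol_enum index_mem mem_nol_enum. Qed.

Lemma ltn_index_nol_enum x y :
  (index x nol_enum < index y nol_enum)%N = nol_lt x y.
Proof.
have le_total : total (@nol_le L).
  move=> u v; rewrite /nol_le; case: eqVneq => //= /nol_lt_total.
  by case/orP=> ->; rewrite ?orbT.
have lt_index u v : (index u nol_enum < index v nol_enum)%N -> nol_lt u v.
  move=> ltuv; have := sorted_ltn_index nol_le_trans (sort_sorted le_total _)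
    u v (mem_nol_enum u) (mem_nol_enum v) ltuv.
  by case/predU1P => // euv; rewrite euv ltnn in ltuv.
apply/idP/idP => [|ltxy]; first exact: lt_index.
case: (ltngtP (index x nol_enum)) => // [/lt_index ltyx|eq_xy].
  by have := nol_lt_trans ltxy ltyx; rewrite nol_lt_irreflexive.
have exy : x = y by rewrite -(nth_index x (mem_nol_enum x)) eq_xy nth_index ?mem_nol_enum.
by move: ltxy; rewrite exy nol_lt_irreflexive.
Qed.

End NaturallyOrdered.

(** * From positive homomorphisms to rigid surjections *)

Section PositiveHom.
Variables (L K : natOrdLattice) (f : {ffun L -> K}).
Hypothesis f_hom : is_hom f.

Lemma hom_mono x y : x <= y -> f x <= f y.
Proof. by case: f_hom => -[fI _ _ _] _ _ /meet_idPl e; rewrite -e fI leIr. Qed.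

Lemma hom_joins (I : finType) (P : {pred I}) (F : I -> L) :
  f (\join_(i | P i) F i) = \join_(i | P i) f (F i).
Proof. by case: f_hom => -[_ fU f0 _] _ _; apply: big_morph. Qed.

Lemma hom_meets (I : finType) (P : {pred I}) (F : I -> L) :
  f (\meet_(i | P i) F i) = \meet_(i | P i) f (F i).
Proof. by case: f_hom => -[fI _ _ f1] _ _; apply: big_morph. Qed.

(** A join-irreducible in the noninjectivity set has the same image as some smaller [y], which is a
    join of smaller join-irreducibles; induction replaces it by ones outside the set. *)
Lemma hom_diff_join x : f (diff_join x (noninjectivity_set f)) = f x.
Proof.
apply: le_anti; rewrite hom_mono ?diff_join_le //=.
suff le_f j : join_irreducible j -> j <= x ->
    f j <= f (diff_join x (noninjectivity_set f)).
  rewrite -{1}(joins_join_irreducible x) hom_joins.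
  by apply/joinsP => j /andP[]; apply: le_f.
move: j; apply: finlattice_ind => j IH ji_j jx.
case fj: (j \in noninjectivity_set f); last first.
  by apply: hom_mono; apply/le_diff_joinP => //; exists j; rewrite fj.
move: fj; rewrite inE => /existsP[y /andP[ltyj /eqP <-]].
rewrite -{1}(joins_join_irreducible y) hom_joins; apply/joinsP => i /andP[ji_i iy].
by apply: IH => //; [apply: le_lt_trans ltyj | apply: le_trans (le_trans iy (ltW ltyj)) jx].
Qed.

(* The least preimage of an element is its [diff_join]; positivity makes the
   least preimages increase with the element. *)
Lemma hom_lt_preimage x y : nol_lt y (f x) -> exists2 x', nol_lt x' x & f x' = y.
Proof.
case: (f_hom) => _ /(_ y)[x1 <-] f_pos lt_fx.
exists (diff_join x1 (noninjectivity_set f)); last exact: hom_diff_join.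
apply: contraTT lt_fx; rewrite -!nol_leNlt => le_x; apply: f_pos.
exact: nol_le_trans (le_nol_le (diff_join_le _ _)) le_x.
Qed.

Lemma rg_hom : rg 0 #|K| [seq index (f x) (nol_enum K) | x <- nol_enum L].
Proof.
set G := map _ _.
have G_occurs y : (y < #|K|)%N -> y \in G.
  move=> yK; case: (f_hom) => _ /(_ (nth \bot (nol_enum K) y))[x fx] _.
  apply/mapP; exists x; first exact: mem_nol_enum.
  by rewrite fx index_uniq ?size_nol_enum // sort_uniq enum_uniq.
apply: rg_first_occurrences => //.
  by move=> y /mapP[x _ ->]; apply: index_nol_enum.
move=> y' y _ lty yK; have yG := G_occurs y yK; rewrite -index_mem in yG.
have sG : size G = size (nol_enum L) by rewrite size_map.
(* [x] is the first element of [L] mapped to the element of rank [y]; an earlier element will be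
   found over rank [y']. *)
set x := nth \bot (nol_enum L) (index y G).
have fx : index (f x) (nol_enum K) = y.
  rewrite -[RHS](nth_index 0 (G_occurs y yK)) (nth_map \bot) //.
  by rewrite -sG.
have y'E : index (nth \bot (nol_enum K) y') (nol_enum K) = y'.
  rewrite index_uniq ?size_nol_enum ?sort_uniq ?enum_uniq //.
  exact: ltn_trans lty yK.
have [x' ltx' fx'] : exists2 x', nol_lt x' x & f x' = nth \bot (nol_enum K) y'.
  by apply: hom_lt_preimage; rewrite -ltn_index_nol_enum fx y'E.
have x_index : index x (nol_enum L) = index y G.
  by rewrite index_uniq ?sort_uniq ?enum_uniq // -sG.
rewrite -x_index; move: ltx'; rewrite -ltn_index_nol_enum; apply: leq_ltn_trans.
rewrite leqNgt; apply/negP => /(before_find 0) /=.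
rewrite (nth_map \bot) ?index_mem ?mem_nol_enum // nth_index ?mem_nol_enum //.
by rewrite fx' y'E eqxx.
Qed.

End PositiveHom.

(** * The free distributive lattice on n generators *)

Section Upsets.
Variable n : nat.

Definition upward_closed (D : {set {set 'I_n}}) : bool :=
  [forall S in D, forall T : {set 'I_n}, (S \subset T) ==> (T \in D)].

Record upset := Upset { upset_val : {set {set 'I_n}}; _ : upward_closed upset_val }.

HB.instance Definition _ := [isSub for upset_val].
HB.instance Definition _ := [Finite of upset by <:].

Lemma upward_closedP (D : {set {set 'I_n}}) :
  reflect (forall S T : {set 'I_n}, S \in D -> S \subset T -> T \in D) (upward_closed D).
Proof.
apply: (iffP forallP) => [DP S T SD ST|DP S].
  by move/implyP: (DP S) => /(_ SD)/forallP/(_ T)/implyP; apply.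
by apply/implyP => SD; apply/forallP => T; apply/implyP; apply: DP.
Qed.

Lemma upset_closed (D : upset) (S T : {set 'I_n}) :
  S \in val D -> S \subset T -> T \in val D.
Proof. by move: S T; apply/upward_closedP; apply: valP. Qed.

Fact upset_meet_subproof (D E : upset) : upward_closed (val D :&: val E).
Proof.
apply/upward_closedP => S T; rewrite !inE => /andP[SD SE] ST.
by rewrite !(upset_closed _ ST).
Qed.

Fact upset_join_subproof (D E : upset) : upward_closed (val D :|: val E).
Proof.
apply/upward_closedP => S T; rewrite !inE => /orP[] SD ST.
  by rewrite (upset_closed SD ST).
by rewrite (upset_closed SD ST) orbT.
Qed.

Fact upset0_subproof : upward_closed set0.
Proof. by apply/upward_closedP => S T; rewrite inE. Qed.

Fact upsetT_subproof : upward_closed setT.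
Proof. by apply/upward_closedP => S T; rewrite !inE. Qed.

Fact principal_subproof (S : {set 'I_n}) :
  upward_closed [set T : {set 'I_n} | S \subset T].
Proof. by apply/upward_closedP => T U; rewrite !inE; apply: subset_trans. Qed.

Definition upset_meet D E := Upset (upset_meet_subproof D E).
Definition upset_join D E := Upset (upset_join_subproof D E).
Definition upset_le (D E : upset) := val D \subset val E.
Definition principal S := Upset (principal_subproof S).

Fact upset_le_def D E : upset_le D E = (upset_meet D E == D).
Proof. by rewrite -val_eqE /=; apply/setIidPl/eqP. Qed.

Fact upset_meetC : commutative upset_meet.
Proof. by move=> D E; apply: val_inj; apply: setIC. Qed.

Fact upset_joinC : commutative upset_join.
Proof. by move=> D E; apply: val_inj; apply: setUC. Qed.

Fact upset_meetA : associative upset_meet.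
Proof. by move=> D E F; apply: val_inj; apply: setIA. Qed.

Fact upset_joinA : associative upset_join.
Proof. by move=> D E F; apply: val_inj; apply: setUA. Qed.

Fact upset_joinKI E D : upset_meet D (upset_join D E) = D.
Proof. by apply: val_inj; apply/setIidPl; apply: subsetUl. Qed.

Fact upset_meetKU E D : upset_join D (upset_meet D E) = D.
Proof. by apply: val_inj; apply/setUidPl; apply: subsetIl. Qed.

Fact upset_meetUl : left_distributive upset_meet upset_join.
Proof. by move=> D E F; apply: val_inj; apply: setIUl. Qed.

Fact upset_meetxx : idempotent_op upset_meet.
Proof. by move=> D; apply: val_inj; apply: setIid. Qed.

Fact upset_display : Order.disp_t. Proof. exact: Order.Disp tt tt. Qed.

HB.instance Definition _ := Order.isMeetJoinDistrLattice.Build upset_display upset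
  upset_le_def (fun _ _ => erefl) upset_meetC upset_joinC upset_meetA upset_joinA
  upset_joinKI upset_meetKU upset_meetUl upset_meetxx.

Fact upset_le0 D : (Upset upset0_subproof : upset) <= D.
Proof. exact: sub0set. Qed.

Fact upset_leT D : D <= (Upset upsetT_subproof : upset).
Proof. exact: subsetT. Qed.

HB.instance Definition _ := Order.hasBottom.Build upset_display upset upset_le0.
HB.instance Definition _ := Order.hasTop.Build upset_display upset upset_leT.

Lemma principal_le S (D : upset) : (principal S <= D) = (S \in val D).
Proof.
apply/subsetP/idP => [|SD T]; first by apply; rewrite inE.
by rewrite inE; apply: upset_closed.
Qed.

Lemma principal_inj : injective principal.
Proof.
move=> S T eST; apply/eqP; rewrite eqEsubset.
have leST : principal S <= principal T by rewrite eST.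
have leTS : principal T <= principal S by rewrite eST.
by move: leST leTS; rewrite !principal_le !inE => -> ->.
Qed.

Lemma join_irreducible_principal S : join_irreducible (principal S).
Proof.
apply/andP; split.
  apply/eqP => eS; have : S \in val (principal S) by rewrite inE.
  by rewrite eS inE.
apply/forallP => D; apply/forallP => E; apply/implyP => /eqP SDE.
have : S \in val (D `|` E) by rewrite -SDE inE.
rewrite inE -!principal_le => /orP[] le_S; apply/orP; [left|right];
  by rewrite eq_le le_S SDE ?leUl ?leUr.
Qed.

Lemma principal_of_join_irreducible (D : upset) :
  join_irreducible D -> exists S, D = principal S.
Proof.
move=> ji_D; have [|S SD leDS] := @join_irreducible_le_joins _ upset _
  [pred S | S \in val D] principal D ji_D.
  apply/subsetP => S SD; rewrite -principal_le.
  by apply: joins_sup; rewrite inE.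
by exists S; apply: le_anti; rewrite leDS principal_le.
Qed.

(** [S] comes before [T] when the least coordinate where they differ lies in [S]. Proper supersets
    come first, since [principal] reverses inclusion. *)
Definition first_diff (S T : {set 'I_n}) : bool :=
  [exists t in S, (t \notin T) &&
     [forall u : 'I_n, (u < t)%N ==> ((u \in S) == (u \in T))]].

Lemma first_diffP (S T : {set 'I_n}) :
  reflect (exists t : 'I_n, [/\ t \in S, t \notin T &
             forall u : 'I_n, (u < t)%N -> (u \in S) = (u \in T)])
          (first_diff S T).
Proof.
apply: (iffP existsP) => -[t].
  by case/and3P=> tS tT /forallP tP; exists t; split=> // u /(implyP (tP u))/eqP.
case=> tS tT tP; exists t; rewrite tS tT; apply/forallP => u; apply/implyP => ut.
by rewrite tP.
Qed.

Lemma first_diff_irreflexive : irreflexive first_diff.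
Proof. by move=> S; apply/negbTE/first_diffP => -[t [-> ]]. Qed.

Lemma first_diff_trans : transitive first_diff.
Proof.
move=> T S U /first_diffP[t [tS tT tP]] /first_diffP[u [uT uU uP]].
apply/first_diffP; case: (ltngtP t u) => [tu|ut|/val_inj e].
- by exists t; rewrite -uP //; split=> // v vt; rewrite tP // uP // (ltn_trans vt).
- by exists u; rewrite tP //; split=> // v vu; rewrite tP ?uP // (ltn_trans vu).
by rewrite e uT in tT.
Qed.

Lemma first_diff_at (S T : {set 'I_n}) : S != T ->
  exists2 t : 'I_n, (t \in S) != (t \in T) &
    forall u : 'I_n, (u < t)%N -> (u \in S) = (u \in T).
Proof.
move=> neq_ST; have [t0 t0P] : exists t, (t \in S) != (t \in T).
  apply/existsP; apply: contraR neq_ST; rewrite negb_exists => /forallP eST.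
  by apply/eqP/setP => t; apply/eqP; rewrite -[_ == _]negbK.
case: (arg_minnP (fun t : 'I_n => t : nat) (P := fun t => (t \in S) != (t \in T)) t0P).
move=> t tP t_min; exists t => // u ltut; apply/eqP; apply: contraLR ltut => uP.
by rewrite -leqNgt t_min.
Qed.

Lemma first_diff_total S T : S != T -> first_diff S T || first_diff T S.
Proof.
case/first_diff_at => t; case tS: (t \in S); case tT: (t \in T) => // _ tP; apply/orP.
  by left; apply/first_diffP; exists t; rewrite tS tT.
by right; apply/first_diffP; exists t; rewrite tS tT; split=> // u /tP.
Qed.

Definition principal_ext (D E : upset) : bool :=
  [exists S, exists T, [&& D == principal S, E == principal T & first_diff S T]].

Lemma principal_extE S T : principal_ext (principal S) (principal T) = first_diff S T.
Proof.
apply/existsP/idP => [[S' /existsP[T' /and3P[/eqP eS /eqP eT]]]|ST].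
  by rewrite (principal_inj eS) (principal_inj eT).
by exists S; apply/existsP; exists T; rewrite !eqxx.
Qed.

Lemma linear_extension_principal : linear_extension principal_ext.
Proof.
split.
- move=> D /principal_of_join_irreducible[S ->].
  by rewrite principal_extE first_diff_irreflexive.
- move=> E D F /principal_of_join_irreducible[S ->].
  case/principal_of_join_irreducible=> [T ->] /principal_of_join_irreducible[U ->].
  by rewrite !principal_extE; apply: first_diff_trans.
- move=> D E /principal_of_join_irreducible[S ->] /principal_of_join_irreducible[T ->].
  by rewrite !principal_extE (inj_eq principal_inj); apply: first_diff_total.
move=> D E /principal_of_join_irreducible[S ->] /principal_of_join_irreducible[T ->].
rewrite principal_extE lt_neqAle (inj_eq principal_inj) principal_le inE.
case/andP=> /first_diff_at[t neq_t tP] /subsetP TS.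
apply/first_diffP; exists t; move: neq_t (TS t).
by case: (t \in S); case: (t \in T) => // _ /(_ isT).
Qed.

Fact upset_natural : natural_order (antilex principal_ext).
Proof. by exists principal_ext => //; apply: linear_extension_principal. Qed.

Definition upset_nol : natOrdLattice := NatOrdLattice upset_natural.

End Upsets.

(** * From rigid surjections to positive homomorphisms *)

Section FreeExtension.
Variables (n : nat) (K : natOrdLattice).

(* [upset_nol n] is the free distributive lattice on ['I_n]; this is the
   homomorphism extending [W] on the generators. *)
Definition free_ext (W : 'I_n -> K) : {ffun upset_nol n -> K} :=
  [ffun D : upset_nol n => \join_(S in upset_val D) \meet_(t in S) W t].

(** This computes the Birkhoff dual of [free_ext W]. Join-primeness puts [j] below the meet over a
    single [S] in [D], and [D] is upward closed. *)
Lemma le_free_ext W (D : upset_nol n) j : join_irreducible j ->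
  (j <= free_ext W D) = ([set t | j <= W t] \in upset_val D).
Proof.
move=> ji_j; rewrite ffunE; apply/idP/idP => [|jD].
  case/(join_irreducible_le_joins ji_j) => S SD /meetsP jS.
  by apply: (upset_closed SD); apply/subsetP => t tS; rewrite inE jS.
apply: le_trans (joins_sup _ jD); apply/meetsP => t; by rewrite inE.
Qed.

Variable W : 'I_n -> K.
Hypothesis W_surj : forall x, exists t, W t = x.
Hypothesis W_rigid : forall x t, nol_lt x (W t) -> exists2 u : 'I_n, (u < t)%N & W u = x.

(** Let [r s j] and let [t] be the first coordinate where the two sets differ. Then [W t] is not
    before [s]; if it came after [s], rigidity would give an earlier [u] with [W u = s], where the
    sets already differ. So [W t = s], and [t] lies in the first set only. *)
Lemma free_ext_first_diff (r : rel K) : linear_extension r -> @nol_lt K =2 antilex r ->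
  forall s j, join_irreducible s -> join_irreducible j ->
  first_diff [set t | s <= W t] [set t | j <= W t] = r s j.
Proof.
move=> hr ltE.
have diff s j : join_irreducible s -> join_irreducible j -> r s j ->
    first_diff [set t | s <= W t] [set t | j <= W t].
  move=> ji_s ji_j sj; have [ts Wts] := W_surj s.
  have jNs : ~~ (j <= s) by apply: (linear_extension_nle hr).
  have [|t] := @first_diff_at _ [set t | s <= W t] [set t | j <= W t].
    by apply/eqP/setP => /(_ ts); rewrite !inE Wts lexx (negPf jNs).
  rewrite !inE => neq_t tP.
  have le_s : nol_le s (W t).
    have : (s <= W t) || (j <= W t) by case: (s <= _) neq_t; case: (j <= _).
    case/orP=> [/le_nol_le//|/le_nol_le]; apply: nol_le_trans.
    by rewrite /nol_le ltE antilex_join_irreducible ?orbT.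
  have {le_s} Wt : W t = s.
    case/predU1P: le_s => [//|/W_rigid[u ut Wu]].
    by have := tP u ut; rewrite !inE Wu lexx (negPf jNs).
  apply/first_diffP; exists t; split=> //; rewrite inE Wt ?lexx //.
case: (hr) => rI rT rtot _ s j ji_s ji_j; apply/idP/idP; last exact: diff.
have [-> |neq_sj] := eqVneq s j; first by rewrite first_diff_irreflexive.
case/orP: (rtot s j ji_s ji_j neq_sj) => // /(diff _ _ ji_j ji_s) js sj.
by have := first_diff_trans sj js; rewrite first_diff_irreflexive.
Qed.

Lemma free_ext_lattice_hom : lattice_hom (free_ext W).
Proof.
split.
- move=> D E; apply: eq_join_irreducible => j ji_j.
  by rewrite lexI !le_free_ext // inE.
- move=> D E; apply: eq_join_irreducible => j ji_j.
  by rewrite join_irreducible_leU // !le_free_ext // inE.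
- apply: eq_join_irreducible => j ji_j.
  by rewrite le_free_ext // inE join_irreducible_le0.
apply: eq_join_irreducible => j ji_j.
by rewrite le_free_ext // inE lex1.
Qed.

Lemma free_ext_surjective : surjective (free_ext W).
Proof.
move=> x; have [t Wt] := W_surj x.
exists (principal [set t]); apply: eq_join_irreducible => j ji_j.
by rewrite le_free_ext // !inE sub1set inE Wt.
Qed.

(** Every up-set strictly below loses the point dual to [j], so [j] is no longer below its image. *)
Lemma principal_noninjectivity j : join_irreducible j ->
  principal [set t | j <= W t] \notin noninjectivity_set (free_ext W).
Proof.
move=> ji_j; rewrite inE negb_exists; apply/forallP => D.
rewrite negb_and -implybE; apply/implyP => ltD.
have jD : [set t | j <= W t] \notin upset_val D.
  by rewrite -principal_le (lt_geF ltD).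
apply/eqP => eD; move: jD; rewrite -le_free_ext // eD le_free_ext // inE.
by rewrite subxx.
Qed.

(** The join [D] of the dual points of all [j] below the image of [principal S] has that same image,
    so injectivity forces [D = principal S], and join-primeness selects one [j]. *)
Lemma principal_injectivity S :
  principal S \notin noninjectivity_set (free_ext W) ->
  exists2 j, join_irreducible j & S = [set t | j <= W t].
Proof.
set x := free_ext W (principal S) => S_inj.
pose D : upset_nol n :=
  \join_(j | join_irreducible j && (j <= x)) principal [set t | j <= W t].
have leDS : D <= principal S.
  by apply/joinsP => j /andP[ji_j]; rewrite principal_le -le_free_ext.
have fD : free_ext W D = x.
  apply: eq_join_irreducible => j ji_j; apply/idP/idP => [|jx].
    rewrite !le_free_ext // => jD.
    by have := subsetP leDS _ jD.
  rewrite le_free_ext // -principal_le.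
  by apply: (joins_min (j := j)); rewrite ?ji_j.
have eDS : D = principal S.
  apply/eqP; apply: contraR S_inj => neqDS; rewrite inE; apply/existsP; exists D.
  by rewrite lt_neqAle neqDS leDS fD /=.
have : principal S <= D by rewrite eDS.
case/(join_irreducible_le_joins (join_irreducible_principal S)) => j /andP[ji_j jx] le_S.
exists j => //; apply: principal_inj; apply: le_anti; rewrite le_S /=.
by rewrite principal_le -le_free_ext.
Qed.

Lemma free_ext_positive : positive (free_ext W).
Proof.
move=> D E; rewrite !nol_leNlt; apply: contraNN.
have [r hr ltE] := nol_natural K; rewrite ltE => /antilexP[s [ji_s sD sE sP]].
(* The deciding join-irreducible upstairs is the dual point of [s], which lies outside the
   noninjectivity set. *)
rewrite /= ; apply/antilexP; exists (principal [set t | s <= W t]); split.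
- exact: join_irreducible_principal.
- apply: contra sD => /le_trans/(_ (diff_join_le _ _)).
  by rewrite principal_le -le_free_ext.
- apply/le_diff_joinP; first exact: join_irreducible_principal.
  exists (principal [set t | s <= W t]); split=> //.
  + exact: join_irreducible_principal.
  + by rewrite principal_le -le_free_ext.
  exact: principal_noninjectivity.
move=> P /[dup] ji_P /principal_of_join_irreducible[S ->].
rewrite principal_extE => sS.
(* A later [principal S] below the difference lies below some [principal U] outside the
   noninjectivity set, dual to some [j]. As [U] is [S] or comes after it, [r s j] holds, and there
   the two images agree. *)
have half D1 D2 : (forall j, join_irreducible j -> r s j ->
      j <= free_ext W D1 -> j <= free_ext W D2) ->
    principal S <= diff_join D1 (noninjectivity_set (free_ext W)) ->
    principal S <= diff_join D2 (noninjectivity_set (free_ext W)).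
  move=> D12 /le_diff_joinP-/(_ (join_irreducible_principal S)).
  case=> _ [/principal_of_join_irreducible[U ->] UD1 U_inj SU].
  have [j ji_j eU] := principal_injectivity U_inj.
  apply/le_diff_joinP; first exact: join_irreducible_principal.
  exists (principal U); split; [exact: join_irreducible_principal | | exact: U_inj | exact: SU].
  have jD1 : j <= free_ext W D1 by rewrite le_free_ext // -principal_le -eU; apply: UD1.
  rewrite principal_le eU -le_free_ext //; apply: D12 jD1 => //.
  rewrite -(free_ext_first_diff hr ltE) // -eU.
  move: SU; rewrite le_eqVlt => /orP[/eqP/principal_inj <- //|ltSU].
  apply: first_diff_trans sS _; rewrite -principal_extE.
  have [_ _ _ ext] := linear_extension_principal n.
  exact: ext (join_irreducible_principal S) (join_irreducible_principal U) ltSU.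
by apply/idP/idP; apply: half => j ji_j sj; rewrite sP.
Qed.

Lemma free_ext_is_hom : is_hom (free_ext W).
Proof.
split; [exact: free_ext_lattice_hom | exact: free_ext_surjective | exact: free_ext_positive].
Qed.

End FreeExtension.

(** * Transfer of the Graham-Rothschild theorem *)

Definition word_map (K : natOrdLattice) (n : nat) (w : seq nat) (t : 'I_n) : K :=
  nth \bot (nol_enum K) (nth 0%N w t).

Lemma word_hom (K : natOrdLattice) n w : size w = n -> rg 0 #|K| w ->
  is_hom (free_ext (@word_map K n w)).
Proof.
move=> sw rw.
have occurs x : index x (nol_enum K) \in w.
  have [|//] := before_rg rw (y := index x (nol_enum K)).
  by rewrite index_nol_enum.
have pos_lt x : (index (index x (nol_enum K)) w < n)%N by rewrite -sw index_mem.
have at_pos x : word_map K w (Ordinal (pos_lt x)) = x.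
  by rewrite /word_map /= nth_index // nth_index ?mem_nol_enum.
apply: free_ext_is_hom => [x|x t lt_x]; first by exists (Ordinal (pos_lt x)).
exists (Ordinal (pos_lt x)) => //=.
have wt : nth 0%N w t \in w by rewrite mem_nth // sw.
have wtK : (nth 0%N w t < #|K|)%N := rg_lt rw wt.
have idx : index (word_map K w t) (nol_enum K) = nth 0%N w t.
  by rewrite /word_map index_uniq ?size_nol_enum // sort_uniq enum_uniq.
apply: leq_trans (rg_index_lt rw _ wtK) _.
  by rewrite -idx ltn_index_nol_enum.
rewrite leqNgt; apply/negP => /(before_find 0%N) /=.
by rewrite eqxx.
Qed.

Lemma comp_free_ext (n : nat) (L K : natOrdLattice) (f : {ffun L -> K}) (W : 'I_n -> L) :
  is_hom f -> comp_hom f (free_ext W) = free_ext (fun t => f (W t)).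
Proof.
move=> f_hom; apply/ffunP => D; rewrite !ffunE hom_joins //.
by apply: eq_bigr => S _; rewrite hom_meets.
Qed.

Lemma eq_free_ext (n : nat) (K : natOrdLattice) (W W' : 'I_n -> K) :
  W =1 W' -> free_ext W = free_ext W'.
Proof.
move=> eW; apply/ffunP => D; rewrite !ffunE; apply: eq_bigr => S _.
by apply: eq_bigr => t _; rewrite eW.
Qed.

Theorem corollary3p8 (k : nat) (hk : (2 <= k)%N) (K L : natOrdLattice)
    (hLK : exists f : {ffun L -> K}, is_hom f) :
  exists N : natOrdLattice,
    forall M : 'I_k -> {set {ffun N -> K}},
      is_coloring (fun f : {ffun N -> K} => is_hom f) M ->
      exists (i : 'I_k) (w : {ffun N -> L}),
        is_hom w /\
        forall f : {ffun L -> K}, is_hom f -> comp_hom f w \in M i.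
Proof.
(* The alphabet is empty, so the words are rigid surjections onto the chains [K] and [L]. *)
have [n GR] := graham_rothschild #|K| 0 #|L| 'I_k.
exists (upset_nol n) => M [M_cover _].
pose i0 : 'I_k := Ordinal (ltnW hk).
pose hom_of w := free_ext (@word_map K n w).
(* The default [i0] serves words whose extension lies in no class; [colP] excludes this for rigid
   surjections. *)
pose col w : 'I_k := odflt i0 [pick i | hom_of w \in M i].
have colP w : size w = n -> rg 0 #|K| w -> hom_of w \in M (col w).
  move=> sw rw; have /M_cover[i iP] := word_hom sw rw.
  by rewrite /col; case: pickP => [//|/(_ i)]; rewrite iP.
have [F [i [sF rF FP]]] := GR col.
exists i, (free_ext (@word_map L n F)); split; first exact: word_hom.
move=> f f_hom; set G := [seq index (f x) (nol_enum K) | x <- nol_enum L].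
have rG : rg 0 #|K| G := rg_hom f_hom.
have sG : size G = #|L| by rewrite size_map size_nol_enum.
have rFG : rg 0 #|K| (wcomp 0 F G) by apply: rg_wcomp; rewrite ?sG.
suff -> : comp_hom f (free_ext (@word_map L n F)) = hom_of (wcomp 0 F G).
  by rewrite -(FP G sG rG); apply: colP; rewrite ?size_wcomp.
rewrite comp_free_ext //; apply: eq_free_ext => t; rewrite /word_map.
have tF : (t < size F)%N by rewrite sF.
have Ft : (nth 0%N F t < size (nol_enum L))%N.
  by rewrite size_nol_enum; apply: rg_lt rF _; rewrite mem_nth.
rewrite (nth_map 0%N) // /letter_subst ltn0 subn0 (nth_map \bot) //.
by rewrite nth_index ?mem_nol_enum.
Qed.
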